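(* Let $n \ge 2$ and let $P$ be an instance of the stable matching problem with $n$ men and $n$ women. Let $R_A$ be the number of rounds after which the man-proposing accelerated deferred acceptance (ADA) algorithm run on $P$ terminates, and let $R_D$ be the number of rounds after which the man-proposing deferred acceptance (DA) algorithm run on $P$ terminates. Then $R_A \le R_D$.
   Context: Instance. $M$ is a set of $n$ men and $W$ is a set of $n$ women, $n \ge 2$. An instance $P$ of the stable matching problem consists of, for each man $m \in M$, a strict preference relation (strict linear order) $\succ_m$ on all of $W$, and, for each woman $w \in W$, a strict preference relation (strict linear order) $\succ_w$ on all of $M$. The two (man-proposing) algorithms. Both proceed in rounds $1, 2, 3, \dots$. Initially all men are single, no woman has rejected any man, and no one is matched. Each round has three steps: 1. Each man who is single at the start of the round proposes to his most preferred woman among those who have not yet rejected him. 2. Each woman $w$ who holds at least one proposal tentatively accepts her most preferred proposer $m^*$ (with respect to $\succ_w$). Here the proposers of $w$ in a round are the men who propose to her in that round together with the man, if any, with whom she was tentatively matched at the end of the previous round. Then: - in DA, $w$ rejects all of her proposers that she ranks below $m^*$; - in ADA, $w$ rejects all men in $M$ that she ranks below $m^*$, whether or not they have proposed to her. Rejections are permanent. 3. The man accepted by $w$ is tentatively matched with $w$; every man who is not tentatively matched at the end of the round is single for the next round. The algorithm terminates at the end of the first round after which no man is single, and it returns the current set of tentatively matched pairs. The number of rounds of a run is the index of this last round. *)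

(* Defs.v *)
(* MathComp world. *)
From mathcomp Require Import all_boot.
Set Implicit Arguments.
Unset Strict Implicit.
Unset Printing Implicit Defensive.

Definition strict_linear_order (T : eqType) (r : rel T) : Prop :=
  [/\ irreflexive r, transitive r & forall x y, x != y -> r x y || r y x].

(* [prefM m w w'] reads "m strictly prefers w to w'"; similarly for [prefW]. *)
Record instance (n : nat) (M W : finType) := Instance {
  prefM : M -> rel W;
  prefW : W -> rel M;
  card_men : #|M| = n;
  card_women : #|W| = n;
  prefM_slo : forall m, strict_linear_order (prefM m);
  prefW_slo : forall w, strict_linear_order (prefW w)
}.

Inductive algorithm := DA | ADA.

(* [(m, w) \in rejected s]: w has rejected m;
   [(m, w) \in matched s]: m and w are tentatively matched. *)
Record state (M W : finType) := State {
  rejected : {set M * W};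
  matched : {set M * W}
}.

Section Algorithms.
Variables (n : nat) (M W : finType) (P : instance n M W).
Implicit Types (s : state M W) (m : M) (w : W) (a : algorithm).

Definition single s m : bool := [forall w, (m, w) \notin matched s].

(* In the five definitions below, [s] is the state at the start of the round. *)

Definition proposes s m w : bool :=
  [&& single s m, (m, w) \notin rejected s
    & [forall w', ((m, w') \notin rejected s) ==> (w' == w) || prefM P m w w']].

Definition proposer s w m : bool := proposes s m w || ((m, w) \in matched s).

Definition accepts s w m : bool :=
  proposer s w m
  && [forall m', proposer s w m' ==> (m' == m) || prefW P w m m'].

Definition rejects a s w m : bool :=
  [exists m', accepts s w m' && prefW P w m' m]
  && (if a is DA then proposer s w m else true).

Definition round a s : state M W :=
  State (rejected s :|: [set p | rejects a s p.2 p.1])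
        [set p | accepts s p.2 p.1].

Definition init : state M W := State set0 set0.

(* State at the end of round [r], rounds being numbered from 1. *)
Definition run a (r : nat) : state M W := iter r (round a) init.

Definition stops_at a (r : nat) : bool :=
  (0 < r) && [forall m, ~~ single (run a r) m].

Lemma slo_asym (T : eqType) (r : rel T) x y :
  strict_linear_order r -> r x y -> r y x -> False.
Proof. by move=> [irr tr _] xy yx; have := tr _ _ _ xy yx; rewrite irr. Qed.

Lemma slo_max (T : finType) (r : rel T) (A : pred T) x0 :
  strict_linear_order r -> A x0 ->
  exists2 x, A x & forall y, A y -> (y == x) || r x y.
Proof.
move=> slo Ax0; have [irr tr tot] := slo.
have [x Ax xmax] := arg_maxnP (fun x => #|[set y | r x y]|) Ax0.
exists x => // y Ay; case: eqVneq => //= yx.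
have /orP[ryx|//] := tot _ _ yx.
have : #|[set z | r y z]| <= #|[set z | r x z]| := xmax y Ay.
rewrite leqNgt => /negP[]; apply: proper_card.
apply/properP; split; first by apply/subsetP => z; rewrite !inE; apply: tr.
by exists x; rewrite !inE ?ryx ?irr.
Qed.

Lemma accepts_ex s w m : proposer s w m -> exists m', accepts s w m'.
Proof.
move=> pm; have [m' pm' mx] := slo_max (prefW_slo P w) pm.
by exists m'; rewrite /accepts pm'; apply/forallP => y; apply/implyP/mx.
Qed.

Definition inv s : Prop :=
  [/\ forall m w, (m, w) \in matched s -> (m, w) \notin rejected s,
      forall m w, (m, w) \in rejected s -> exists m', (m', w) \in matched s
    & forall m w w', (m, w) \in matched s -> (m, w') \in matched s -> w = w'].

Lemma inv_round a s : inv s -> inv (round a s).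
Proof.
move=> [Ia Ib Ic]; split=> [m w|m w|m w w'] /=; rewrite !inE /=.
- move=> /andP[pm /forallP mx]; rewrite negb_or; apply/andP; split.
    by case/orP: pm => [/and3P[]//|/Ia].
  apply/negP => /andP[/existsP[m' /andP[/andP[pm' _] m'm]] _].
  have [irr _ _] := prefW_slo P w.
  have := mx m'; rewrite pm' /= => /orP[/eqP e|mm'].
    by rewrite e irr in m'm.
  exact: slo_asym (prefW_slo P w) mm' m'm.
- case/orP=> [/Ib[m' mm']|/andP[/existsP[m' /andP[am' _]] _]].
    have [|m'' am''] := @accepts_ex s w m'; first by rewrite /proposer mm' orbT.
    by exists m''; rewrite inE.
  by exists m'; rewrite inE.
move=> /andP[pm _] /andP[pm' _].
case/orP: pm => [/and3P[sm nr /forallP mx]|mm];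
  case/orP: pm' => [/and3P[sm' nr' /forallP mx']|mm'].
- have := mx w'; rewrite nr' /= => /orP[/eqP->//|ww'].
  have := mx' w; rewrite nr /= => /orP[/eqP->//|w'w].
  by case: (slo_asym (prefM_slo P m) ww' w'w).
- by move/forallP: sm => /(_ w'); rewrite mm'.
- by move/forallP: sm' => /(_ w); rewrite mm.
- exact: Ic mm mm'.
Qed.

Lemma inv_run a r : inv (run a r).
Proof.
elim: r => [|r IH]; last exact: inv_round.
by split=> [m w|m w|m w w'] /=; rewrite inE.
Qed.

Lemma some_left s m : inv s -> single s m -> exists w, (m, w) \notin rejected s.
Proof.
move=> [_ Ib Ic] /forallP sm; apply/existsP; apply: contraT => /existsPn allr.
have ex w : exists m', (m', w) \in matched s.
  by apply: (Ib m); have := allr w; rewrite negbK.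
pose f w := xchoose (ex w); have fP w : (f w, w) \in matched s by apply: (xchooseP (ex w)).
have finj : injective f.
  by move=> w w' e; apply: (Ic (f w)); [exact: fP | rewrite e; exact: fP].
have /(inj_card_onto finj) /(_ m) /codomP[w e] : #|W| >= #|M|.
  by rewrite (card_men P) (card_women P).
by have := sm w; rewrite e fP.
Qed.

Lemma progress a s m : inv s -> single (round a s) m ->
  #|rejected s| < #|rejected (round a s)|.
Proof.
move=> Is sm; have [Ia _ _] := Is; apply: proper_card; apply/properP; split.
  exact: subsetUl.
have [w pm nr] : exists2 w, proposer s w m & (m, w) \notin rejected s.
  have [sm0|] := boolP (single s m); last first.
    by case/forallPn => w; rewrite negbK => mm; exists w; [rewrite /proposer mm orbT | exact: Ia].
  have [w0 nr0] := some_left Is sm0.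
  have [w nr mx] := @slo_max _ _ (fun w => (m, w) \notin rejected s) w0 (prefM_slo P m) nr0.
  exists w => //; apply/orP; left; rewrite /proposes sm0 nr /=.
  by apply/forallP => w'; apply/implyP/mx.
exists (m, w) => //; rewrite !inE /=; apply/orP; right.
have [m' am'] := accepts_ex pm; rewrite /rejects pm; apply/andP; split; last by case: a {sm}.
apply/existsP; exists m'; rewrite am' /=.
case/andP: (am') => _ /forallP/(_ m); rewrite pm /= => /orP[/eqP e|//].
by move/forallP: sm => /(_ w); rewrite inE /= e am'.
Qed.

Lemma stops a : exists r, stops_at a r.
Proof.
have [k] : exists k, k < #|{: M * W}|.+2 /\ stops_at a k; last by case=> _; exists k.
suff [h|//] : (forall r, r <= #|{: M * W}|.+1 -> r <= #|rejected (run a r)|)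
   \/ exists k, k < #|{: M * W}|.+2 /\ stops_at a k.
  by have := leq_trans (h _ (leqnn _)) (max_card _); rewrite ltnn.
have [/existsP[k sk]|/existsPn ns] := boolP [exists k : 'I_(#|{: M * W}|.+2), stops_at a k].
  by right; exists k.
left; elim=> [//|r IH] lr; apply: leq_ltn_trans (IH (ltnW lr)) _.
have := ns (Ordinal (lr : r.+1 < _.+2)); rewrite /stops_at /= => /forallPn[m].
by rewrite negbK; apply: progress; apply: inv_run.
Qed.

Definition num_rounds a : nat := ex_minn (stops a).

End Algorithms.

(* Main.v *)
(** A proposer of [w] is exactly a man whose best woman among those who have not
    yet rejected him is [w], so a run is governed by its rejections alone.  By
    induction on the round, every rejection made by DA has already been made by
    ADA.  On the other hand the final matching of DA is stable, and ADA never
    rejects a stable pair.  Hence, in the round in which DA stops, every man in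
    the ADA run also proposes to his final DA partner, and ADA has stopped as
    well. *)
Require Import Defs.
From mathcomp Require Import all_boot.

Set Implicit Arguments.
Unset Strict Implicit.
Unset Printing Implicit Defensive.

Section Comparison.
Variables (n : nat) (M W : finType) (P : instance n M W).
Implicit Types (s : state M W) (m : M) (w : W) (a : algorithm) (r : nat).

(** Depends on [rejected s] alone, so that two runs can be compared without looking at who is
    matched. *)
Definition favourite s m w : bool :=
  ((m, w) \notin rejected s)
  && [forall w', ((m, w') \notin rejected s) ==> (w' == w) || prefM P m w w'].

Lemma favourite_inj s m w w' : favourite s m w -> favourite s m w' -> w = w'.
Proof.
move=> /andP[nr /forallP mx] /andP[nr' /forallP mx'].
have := mx w'; rewrite nr' /= => /orP[/eqP->//|ww'].
have := mx' w; rewrite nr /= => /orP[/eqP->//|w'w].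
by case: (slo_asym (prefM_slo P m) ww' w'w).
Qed.

Lemma favourite_sub s s' m w : rejected s \subset rejected s' ->
  (m, w) \notin rejected s' -> favourite s m w -> favourite s' m w.
Proof.
move=> /subsetP ss' nr' /andP[_ /forallP mx]; apply/andP; split=> //.
apply/forallP => w'; apply/implyP => nrw'; apply: (implyP (mx w')).
by apply: contra nrw'; apply: ss'.
Qed.

Lemma accepts_inj s w m m' : accepts P s w m -> accepts P s w m' -> m = m'.
Proof.
move=> /andP[pm /forallP mx] /andP[pm' /forallP mx'].
have := mx m'; rewrite pm' /= => /orP[/eqP->//|mm'].
have := mx' m; rewrite pm /= => /orP[/eqP->//|m'm].
by case: (slo_asym (prefW_slo P w) mm' m'm).
Qed.

Lemma accepts_better s w m m' : proposer P s w m' -> prefW P w m' m ->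
  exists2 m'', accepts P s w m'' & prefW P w m'' m.
Proof.
move=> pm' m'm; have [m'' am''] := accepts_ex pm'; exists m'' => //.
case/andP: (am'') => _ /forallP/(_ m'); rewrite pm' /= => /orP[/eqP<-//|m''m'].
by have [_ tr _] := prefW_slo P w; apply: tr m''m' m'm.
Qed.

(** A tentative partner was a proposer one round earlier, hence the favourite then. Rejections only
    shrink the choice, and she has not rejected him, so she remains the favourite. *)
Lemma proposer_favourite a r m w :
  proposer P (run P a r) w m -> favourite (run P a r) m w.
Proof.
elim: r w => [|r IH] w.
  by rewrite /proposer inE orbF => /and3P[_ nr mx]; rewrite /favourite nr.
case/orP=> [/and3P[_ nr mx]|mm]; first by rewrite /favourite nr.
have [Ia _ _] := inv_run P a r.+1.
apply: favourite_sub (Ia _ _ mm) (IH w _); first exact: subsetUl.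
by move: mm; rewrite inE => /andP[].
Qed.

Lemma proposerE a r m w :
  proposer P (run P a r) w m = favourite (run P a r) m w.
Proof.
apply/idP/idP => [|fm]; first exact: proposer_favourite.
have [sm|] := boolP (single (run P a r) m).
  by apply/orP; left; rewrite /proposes sm.
case/forallPn => w'; rewrite negbK => mm; rewrite /proposer.
have fm' : favourite (run P a r) m w'.
  by apply: proposer_favourite; rewrite /proposer mm orbT.
by rewrite (favourite_inj fm fm') mm orbT.
Qed.

(** The man a woman holds proposes again in the next round, so her partner never gets worse. *)
Lemma rejected_better a r m w : (m, w) \in rejected (run P a r) ->
  exists2 m', (m', w) \in matched (run P a r) & prefW P w m' m.
Proof.
elim: r => [|r IH] /=; rewrite !inE //=.
case/orP=> [/IH[m' mm' m'm]|/andP[/existsP[m' /andP[am' m'm]] _]].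
  have [|m'' am'' m''m] := @accepts_better (run P a r) w m m' _ m'm.
    by rewrite /proposer mm' orbT.
  by exists m''; rewrite ?inE.
by exists m'; rewrite ?inE.
Qed.

Lemma rejected_DA_ADA r :
  rejected (run P DA r) \subset rejected (run P ADA r).
Proof.
elim: r => [|r IH]; first exact: subxx.
apply/subsetP => -[m w] /=; rewrite !inE /= => /orP[/(subsetP IH)->//|].
case/andP => /existsP[m' /andP[/andP[pm' _] m'm]] _.
apply/orP; right; rewrite /rejects andbT.
(* If ADA has rejected [m'] at [w], then [w] holds someone even better; otherwise [w] is still the
   favourite of [m'], since ADA has rejected at least as much as DA. *)
have [m1 pm1 m1m] :
    exists2 m1, proposer P (run P ADA r) w m1 & prefW P w m1 m.
  have [/rejected_better[m1 mm1 m1m']|nr] :=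
    boolP ((m', w) \in rejected (run P ADA r)).
    exists m1; first by rewrite /proposer mm1 orbT.
    by have [_ tr _] := prefW_slo P w; apply: tr m1m' m'm.
  by exists m' => //; move: pm'; rewrite !proposerE; apply: favourite_sub.
have [m2 am2 m2m] := accepts_better pm1 m1m.
by apply/existsP; exists m2; rewrite am2.
Qed.

Lemma stops_matched a r : stops_at P a r ->
  forall m, exists w, (m, w) \in matched (run P a r).
Proof.
case/andP=> _ /forallP st m; have /forallPn[w] := st m.
by rewrite negbK; exists w.
Qed.

(** As [w'] is the favourite of [m'], the better [w] must have rejected him, and so holds a man she
    prefers to [m']; that man is [m]. *)
Lemma DA_stable r m m' w w' :
    (m, w) \in matched (run P DA r) -> (m', w') \in matched (run P DA r) ->
  prefM P m' w w' -> ~~ prefW P w m' m.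
Proof.
case: r => [|r]; first by rewrite inE.
move=> mm mm' ww'; apply/negP => m'm.
have : favourite (run P DA r.+1) m' w'.
  by rewrite -proposerE /proposer mm' orbT.
case/andP=> _ /forallP/(_ w)/implyP mx.
have [/rejected_better[m'' mm'' m''m']|nr] :=
  boolP ((m', w) \in rejected (run P DA r.+1)).
  move: mm mm''; rewrite !inE /= => am /(accepts_inj am) e.
  by apply: (slo_asym (prefW_slo P w) m'm); rewrite e.
case/orP: (mx nr) => [/eqP e|w'w].
  by have [irr _ _] := prefM_slo P m'; rewrite e irr in ww'.
exact: slo_asym (prefM_slo P m') ww' w'w.
Qed.

(** Rejecting [m] takes a proposer [m'] whom [w] prefers. By induction [m'] could still propose to
    his DA partner [w'], so either he prefers [w] and blocks the DA matching, or [w = w'] and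
    [m = m']. *)
Lemma ADA_keeps_DA_pairs r k m w : stops_at P DA r ->
  (m, w) \in matched (run P DA r) -> (m, w) \notin rejected (run P ADA k).
Proof.
move=> st; elim: k m w => [|k IH] m w mm; first by rewrite inE.
rewrite /= !inE negb_or (IH _ _ mm) /rejects andbT.
apply/existsPn => m'; apply/negP => /andP[/andP[pm' _] m'm].
have [w' mm'] := stops_matched st m'.
move: pm'; rewrite proposerE => /andP[_ /forallP/(_ w')].
rewrite (IH _ _ mm') /= => /orP[/eqP e|ww']; last first.
  by have := DA_stable mm mm' ww'; rewrite m'm.
case: r {st IH} mm mm' => [|r]; first by rewrite inE.
rewrite e !inE /= => am am'; have [irr _ _] := prefW_slo P w.
by rewrite (accepts_inj am am') irr in m'm.
Qed.

Lemma stops_DA_ADA r : stops_at P DA r -> stops_at P ADA r.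
Proof.
case: r => [//|r] st.
(* Favourites are taken at the start of round [r.+1], matches at its end. *)
have fav m w : (m, w) \in matched (run P DA r.+1) ->
    favourite (run P ADA r) m w.
  move=> mm; apply: favourite_sub (rejected_DA_ADA r) _ _.
    exact: ADA_keeps_DA_pairs st mm.
  by rewrite -proposerE; move: mm; rewrite inE => /andP[].
apply/andP; split=> //; apply/forallP => m; apply/forallPn.
have [w mm] := stops_matched st m; exists w; rewrite negbK inE /=.
(* [m] is the only proposer of [w]: any other man has his own DA partner as favourite. *)
rewrite /accepts proposerE fav //=; apply/forallP => m'; apply/implyP.
rewrite proposerE => fm'; have [w' mm'] := stops_matched st m'.
have e := favourite_inj fm' (fav _ _ mm').
move: mm mm'; rewrite -e !inE /= => am am'.
by rewrite (accepts_inj am am') eqxx.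
Qed.

End Comparison.

Theorem theorem4 (n : nat) (M W : finType) (P : instance n M W) (hn : 2 <= n) :
  num_rounds P ADA <= num_rounds P DA.
Proof.
rewrite /num_rounds; case: ex_minnP => rA _ minA; case: ex_minnP => rD stD _.
exact/minA/stops_DA_ADA.
Qed.
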